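(* Let $F$ be a hyperfield such that the characteristic of the field $F/\alpha^*$ is not $2$, and let $L$ be a Lie hyperalgebra over $F$ such that the fundamental Lie algebra $L/\mathcal{L}^*$ is finite dimensional. Let $\mathcal{S}=\bigcap_{n\ge1}\mathcal{S}_n^*$. Then $\mathcal{S}$ is the smallest equivalence relation on $L$ such that the quotient $L/\mathcal{S}$ is a solvable Lie algebra; that is, $L/\mathcal{S}$ is a solvable Lie algebra, and $\mathcal{S}\subseteq\xi$ for every equivalence relation $\xi$ on $L$ such that $L/\xi$ is a solvable Lie algebra.
   Context: **Hyperstructures.** $\mathscr{P}^*(H)$ is the set of non-empty subsets of $H$. A hyperoperation $\circ:H\times H\to\mathscr{P}^*(H)$ (and likewise any external map or hyperbracket with values in non-empty subsets) is extended to non-empty subsets by $A\circ B=\bigcup_{a\in A,b\in B}a\circ b$; elements are identified with singletons. $(H,\circ)$ is a semihypergroup if $\circ$ is associative, and a hypergroup if moreover $x\circ H=H\circ x=H$ for all $x\in H$. A hyperring $(R,+,\cdot)$: $(R,+)$ is a hypergroup, $(R,\cdot)$ a semihypergroup, and $\cdot$ is distributive over $+$. A hyperfield is a hyperring such that $(R,\cdot)$ (or $(R-\{0\},\cdot)$, if $R$ contains $0$) is a hypergroup. A hypervector space over a hyperfield $F$ is a hypergroup $(M,+)$ with a map $F\times M\to\mathscr{P}^*(M)$, $(a,x)\mapsto a\cdot x=ax$, such that $a(x+y)=ax+ay$, $(a+b)x=ax+bx$, $(ab)x=a(bx)$ for all $a,b\in F$, $x,y\in M$. Standing assumptions: every hypervector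 space $M$ has a scalar identity $0_M$ for $+$ (i.e. $0_M+x=x+0_M=\{x\}$), and every hyperfield $F$ has a scalar identity $0_F$ for $+$ and a multiplication unit $1$, such that $0_F x=\{0_M\}$ and $1x=\{x\}$ for all $x\in M$. **Lie hyperalgebras.** A Lie hyperalgebra over a hyperfield $F$ is a hypervector space $L$ over $F$ with a map (hyperbracket) $[-,-]:L\times L\to\mathscr{P}^*(L)$ that is bilinear, i.e. $[\lambda_1x_1+\lambda_2x_2,y]=\lambda_1[x_1,y]+\lambda_2[x_2,y]$ and $[x,\lambda_1y_1+\lambda_2y_2]=\lambda_1[x,y_1]+\lambda_2[x,y_2]$, such that $0\in[x,x]$ and $0\in[x,[y,z]]+[y,[z,x]]+[z,[x,y]]$ for all $x,y,z\in L$. Put $[A,B]=\bigcup_{a\in A,b\in B}[a,b]$, $L^{[0]}=L$, and $L^{[i]}=[L^{[i-1]},L^{[i-1]}]$ for $i\ge1$. **Hyperbracket functions.** A hyperbracket function $f(g_1,\dots,g_m)$ is an arbitrary composition of the arguments $g_1,\dots,g_m$ using only the hyperbracket (a bracket monomial, each argument used once; for $m=1$, $f(g)=g$), extended to subsets. **The relation $\mathcal{S}_n$.** $\mathbb{S}_t$ is the symmetric group on $\{1,\dots,t\}$. For $n\in\mathbb{N}$ ($n\ge1$) and $x,y\in L$, $x\,\mathcal{S}_n\,y$ if and only if there exist: $t\in\mathbb{N}$ and $\sigma\in\mathbb{S}_t$; for $1\le i\le t$, $m_i\in\mathbb{N}$, a hyperbracket function $f_i$ of $m_i$ arguments, elements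 $h_{i1},\dots,h_{im_i}\in L$, and $\sigma_i\in\mathbb{S}_{m_i}$ such that $\sigma_i(j)=j$ whenever $h_{ij}\notin L^{[n-1]}$; for $1\le j\le m_i$, $p_{ij}\in\mathbb{N}$ and $\sigma_{ij}\in\mathbb{S}_{p_{ij}}$; for $1\le k\le p_{ij}$, $q_{ijk}\in\mathbb{N}$, $\lambda_{ijk1},\dots,\lambda_{ijkq_{ijk}}\in F$ and $\sigma_{ijk}\in\mathbb{S}_{q_{ijk}}$; such that $$x\in\sum_{i=1}^t\ell_i,\quad \ell_i=f_i(g_{i1},\dots,g_{im_i}),\quad g_{ij}=\Big(\sum_{k=1}^{p_{ij}}\big(\prod_{r=1}^{q_{ijk}}\lambda_{ijkr}\big)\Big)\cdot h_{ij},$$ $$y\in\sum_{i=1}^t\ell'_i,\quad \ell'_i=f_{\sigma(i)}(g'_{i1},\dots,g'_{im_{\sigma(i)}}),\quad g'_{ij}=A_{\sigma(i)\sigma_{\sigma(i)}(j)}\cdot h_{\sigma(i)\sigma_{\sigma(i)}(j)}\ (1\le j\le m_{\sigma(i)}),$$ where $A_{ij}=\sum_{k=1}^{p_{ij}}B_{ij\sigma_{ij}(k)}$ and $B_{ijk}=\prod_{r=1}^{q_{ijk}}\lambda_{ijk\sigma_{ijk}(r)}$. (Sums and products are taken in the indicated order.) $\mathcal{S}_n$ is reflexive and symmetric; $\mathcal{S}_n^*$ is its transitive closure. **The relation $\mathcal{L}$.** $x\,\mathcal{L}\,y$ iff $\{x,y\}\subseteq\sum_{i=1}^t\ell_i$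 for some $t\in\mathbb{N}$ and some $\ell_i=f_i(g_{i1},\dots,g_{im_i})$ ($1\le i\le t$), where $m_i\in\mathbb{N}$, $f_i$ is a hyperbracket function of $m_i$ arguments and $g_{ij}=\big(\sum_{k=1}^{p_{ij}}\prod_{r=1}^{q_{ijk}}\lambda_{ijkr}\big)\cdot h_{ij}$ with $p_{ij},q_{ijk}\in\mathbb{N}$, $h_{ij}\in L$, $\lambda_{ijkr}\in F$. $\mathcal{L}^*$ is its transitive closure. **Relations on hyperrings.** On a hyperring $R$: $x\,\gamma\,y$ iff $\{x,y\}$ is contained in some finite sum of finite products of elements of $R$. $x\,\alpha\,y$ iff there exist $t\in\mathbb{N}$, $\sigma\in\mathbb{S}_t$, $k_1,\dots,k_t\in\mathbb{N}$, $\sigma_i\in\mathbb{S}_{k_i}$ and $x_{i1},\dots,x_{ik_i}\in R$ with $x\in\sum_{i=1}^t\big(\prod_{j=1}^{k_i}x_{ij}\big)$ and $y\in\sum_{i=1}^tA_{\sigma(i)}$, where $A_i=\prod_{j=1}^{k_i}x_{i\sigma_i(j)}$. $\gamma^*,\alpha^*$ are the transitive closures. An equivalence relation $\delta$ on $F$ is strongly regular if $x\,\delta\,y$ implies that every element of $a+x$ (resp. $x+a$, $a\cdot x$, $x\cdot a$) is $\delta$-related to every element of $a+y$ (resp. $y+a$, $a\cdot y$, $y\cdot a$) for all $a\in F$; quotients of $F$ carry the induced operations, and $F/\alpha^*$ is a field. **Quotient Lie algebras.** For equivalence relations $\rho$ on $L$ and $\delta$ on $F$ (classes $\bar x$, $\widetilde\lambda$),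 the quotient operations are: $\bar x\oplus\bar y=\bar z$ for all $z\in x+y$; $\widetilde\lambda\odot\bar x=\bar z$ for all $z\in\lambda\cdot x$; $\lfloor\bar x,\bar y\rfloor=\bar z$ for all $z\in[x,y]$. ''$L/\rho$ is a Lie algebra'' means that these operations are well defined and make $L/\rho$ a Lie algebra over the field $F/\delta$ for some strongly regular equivalence relation $\delta$ on $F$ (for $\mathcal{S}_n^*$ one takes $\delta=\alpha^*$; for $\mathcal{L}^*$ one takes $\delta=\gamma^*$, and $L/\mathcal{L}^*$ is then called the fundamental Lie algebra of $L$). **Solvability.** For a Lie algebra $M$, $M^{(0)}=M$ and $M^{(i)}=\lfloor M^{(i-1)},M^{(i-1)}\rfloor$ is the span of brackets of elements of $M^{(i-1)}$. $M$ is solvable of length $m$ if $M^{(m)}=0$ and $M^{(m-1)}\ne0$; it is solvable if $M^{(m)}=0$ for some $m$. *)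

(* Defs.v *)
From HB Require Import structures.
From mathcomp Require Import all_boot all_order all_algebra all_fingroup.
From mathcomp Require Import boolp classical_sets.
From Stdlib Require Relation_Operators.

Set Implicit Arguments.
Unset Strict Implicit.
Unset Printing Implicit Defensive.

Import GRing.Theory.

Local Open Scope classical_set_scope.
Local Open Scope ring_scope.

Definition trans_closure (T : Type) (r : T -> T -> Prop) : T -> T -> Prop :=
  @Relation_Operators.clos_trans T r.

Definition is_equivalence (T : Type) (r : T -> T -> Prop) : Prop :=
  Relation_Definitions.equivalence T r.

Definition nonempty_valued (A B C : Type) (op : A -> B -> set C) : Prop :=
  forall x y, op x y !=set0.

Definition lift (A B C : Type) (op : A -> B -> set C) (X : set A) (Y : set B) :
    set C :=
  \bigcup_(x in X) \bigcup_(y in Y) op x y.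

Definition hyperassociative (T : Type) (op : T -> T -> set T) : Prop :=
  forall x y z, lift op (op x y) [set z] = lift op [set x] (op y z).

(* Reproduction axiom on the subset [D]; it entails that [D] is closed
   under [op]. *)
Definition reproductive_on (T : Type) (D : set T) (op : T -> T -> set T) :
    Prop :=
  forall x, D x -> lift op [set x] D = D /\ lift op D [set x] = D.

Definition scalar_identity (T : Type) (e : T) (op : T -> T -> set T) : Prop :=
  forall x, op e x = [set x] /\ op x e = [set x].

(* [op]-value of a list of subsets, associated to the left.  The value of the
   empty list is [set0] and [lift] is strict in [set0], so an expression in which
   some sum or product is empty has no element: requiring membership in such an
   expression forces all its index ranges to be nonempty. *)
Definition hseq (T : Type) (op : T -> T -> set T) (s : seq (set T)) : set T :=
  if s is X :: s' then foldl (lift op) X s' else set0.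

Definition hfold (T : Type) (op : T -> T -> set T) (n : nat)
    (X : 'I_n -> set T) : set T :=
  hseq op [seq X i | i <- enum 'I_n].

(* The multiplicative unit is only required to satisfy [a \in 1 a] and
   [a \in a 1]. *)
Record hyperfield := Hyperfield {
  hf_car :> Type;
  hf_add : hf_car -> hf_car -> set hf_car;
  hf_mul : hf_car -> hf_car -> set hf_car;
  hf_zero : hf_car;
  hf_one : hf_car;
  hf_add_nonempty : nonempty_valued hf_add;
  hf_mul_nonempty : nonempty_valued hf_mul;
  hf_addA : hyperassociative hf_add;
  hf_add_repr : reproductive_on setT hf_add;
  hf_mulA : hyperassociative hf_mul;
  hf_mulDr : forall a b c,
    lift hf_mul [set a] (hf_add b c) = lift hf_add (hf_mul a b) (hf_mul a c);
  hf_mulDl : forall a b c,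
    lift hf_mul (hf_add a b) [set c] = lift hf_add (hf_mul a c) (hf_mul b c);
  hf_add0 : scalar_identity hf_zero hf_add;
  hf_mul_repr : reproductive_on [set a | a <> hf_zero] hf_mul;
  hf_mul1 : forall a, hf_mul hf_one a a /\ hf_mul a hf_one a
}.

Record sum_prod (R : Type) := SumProd {
  sp_len : nat;
  sp_deg : 'I_sp_len -> nat;
  sp_arg : forall i : 'I_sp_len, 'I_(sp_deg i) -> R
}.

Definition sp_val (F : hyperfield) (E : sum_prod F) : set F :=
  hfold (@hf_add F)
    (fun i : 'I_(sp_len E) =>
       hfold (@hf_mul F) (fun j : 'I_(sp_deg i) => [set sp_arg j])).

(* The i-th product of the new expression is the [s i]-th product of [E], with
   its own factors permuted by [u (s i)]. *)
Definition sp_permute (R : Type) (E : sum_prod R) (s : 'S_(sp_len E))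
    (u : forall i : 'I_(sp_len E), 'S_(sp_deg i)) : sum_prod R :=
  @SumProd R (sp_len E) (fun i => sp_deg (s i))
    (fun i j => sp_arg (u (s i) j)).

Definition gamma (F : hyperfield) (x y : F) : Prop :=
  exists E : sum_prod F, sp_val E x /\ sp_val E y.

Definition alpha (F : hyperfield) (x y : F) : Prop :=
  exists (E : sum_prod F) (s : 'S_(sp_len E))
         (u : forall i : 'I_(sp_len E), 'S_(sp_deg i)),
    sp_val E x /\ sp_val (sp_permute s u) y.

Definition gamma_star (F : hyperfield) : F -> F -> Prop :=
  trans_closure (@gamma F).

Definition alpha_star (F : hyperfield) : F -> F -> Prop :=
  trans_closure (@alpha F).

Definition strongly_regular (F : hyperfield) (d : F -> F -> Prop) : Prop :=
  is_equivalence d /\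
  forall x y, d x y -> forall a,
    [/\ forall u v, hf_add a x u -> hf_add a y v -> d u v,
        forall u v, hf_add x a u -> hf_add y a v -> d u v,
        forall u v, hf_mul a x u -> hf_mul a y v -> d u v
      & forall u v, hf_mul x a u -> hf_mul y a v -> d u v].

Record lieHyperalgebra (F : hyperfield) := LieHyperalgebra {
  lh_car :> Type;
  lh_add : lh_car -> lh_car -> set lh_car;
  lh_scale : F -> lh_car -> set lh_car;
  lh_bracket : lh_car -> lh_car -> set lh_car;
  lh_zero : lh_car;
  lh_add_nonempty : nonempty_valued lh_add;
  lh_scale_nonempty : nonempty_valued lh_scale;
  lh_bracket_nonempty : nonempty_valued lh_bracket;
  lh_addA : hyperassociative lh_add;
  lh_add_repr : reproductive_on setT lh_add;
  lh_scaleDr : forall a x y,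
    lift lh_scale [set a] (lh_add x y)
    = lift lh_add (lh_scale a x) (lh_scale a y);
  lh_scaleDl : forall a b x,
    lift lh_scale (hf_add a b) [set x]
    = lift lh_add (lh_scale a x) (lh_scale b x);
  lh_scaleA : forall a b x,
    lift lh_scale (hf_mul a b) [set x] = lift lh_scale [set a] (lh_scale b x);
  lh_add0 : scalar_identity lh_zero lh_add;
  lh_scale0 : forall x, lh_scale (hf_zero F) x = [set lh_zero];
  lh_scale1 : forall x, lh_scale (hf_one F) x = [set x];
  lh_bracket_linl : forall a1 a2 x1 x2 y,
    lift lh_bracket (lift lh_add (lh_scale a1 x1) (lh_scale a2 x2)) [set y]
    = lift lh_add (lift lh_scale [set a1] (lh_bracket x1 y))
                  (lift lh_scale [set a2] (lh_bracket x2 y));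
  lh_bracket_linr : forall a1 a2 x y1 y2,
    lift lh_bracket [set x] (lift lh_add (lh_scale a1 y1) (lh_scale a2 y2))
    = lift lh_add (lift lh_scale [set a1] (lh_bracket x y1))
                  (lift lh_scale [set a2] (lh_bracket x y2));
  lh_bracket_alt : forall x, lh_bracket x x lh_zero;
  lh_jacobi : forall x y z,
    lift lh_add
      (lift lh_add (lift lh_bracket [set x] (lh_bracket y z))
                   (lift lh_bracket [set y] (lh_bracket z x)))
      (lift lh_bracket [set z] (lh_bracket x y)) lh_zero
}.

Definition hyper_derived (F : hyperfield) (L : lieHyperalgebra F) (n : nat) :
    set L :=
  iter n (fun A => lift (@lh_bracket F L) A A) setT.

(* A hyperbracket function of [m] arguments is a binary tree whose leaves are
   labelled by ['I_m], each label occurring exactly once. *)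
Inductive monomial (m : nat) :=
  | Leaf of 'I_m
  | Bracket of monomial m & monomial m.

Fixpoint leaves (m : nat) (f : monomial m) : seq 'I_m :=
  match f with
  | Leaf i => [:: i]
  | Bracket f1 f2 => leaves f1 ++ leaves f2
  end.

Fixpoint monomial_val (F : hyperfield) (L : lieHyperalgebra F) (m : nat)
    (g : 'I_m -> set L) (f : monomial m) : set L :=
  match f with
  | Leaf i => g i
  | Bracket f1 f2 =>
      lift (@lh_bracket F L) (monomial_val g f1) (monomial_val g f2)
  end.

(* [g_j] is the value of [lt_coef j] acting on [lt_vec j]. *)
Record lie_term (F : hyperfield) (L : lieHyperalgebra F) := LieTerm {
  lt_arity : nat;
  lt_fun : monomial lt_arity;
  lt_funP : perm_eq (leaves lt_fun) (enum 'I_lt_arity);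
  lt_coef : 'I_lt_arity -> sum_prod F;
  lt_vec : 'I_lt_arity -> L
}.

Definition lt_val (F : hyperfield) (L : lieHyperalgebra F) (l : lie_term L) :
    set L :=
  monomial_val
    (fun j => lift (@lh_scale F L) (sp_val (lt_coef j)) [set lt_vec j])
    (lt_fun l).

Record lie_term_perm (F : hyperfield) (L : lieHyperalgebra F)
    (l : lie_term L) := LieTermPerm {
  lp_args : 'S_(lt_arity l);
  lp_sum : forall j : 'I_(lt_arity l), 'S_(sp_len (lt_coef j));
  lp_prod : forall (j : 'I_(lt_arity l)) (k : 'I_(sp_len (lt_coef j))),
    'S_(sp_deg k)
}.

Definition lt_permute (F : hyperfield) (L : lieHyperalgebra F)
    (l : lie_term L) (w : lie_term_perm l) : lie_term L :=
  @LieTerm F L (lt_arity l) (lt_fun l) (lt_funP l)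
    (fun j => sp_permute (@lp_sum F L l w (lp_args w j))
                         (@lp_prod F L l w (lp_args w j)))
    (fun j => lt_vec (lp_args w j)).

(* Only meaningful for [n >= 1]: [S_rel 0] coincides with [S_rel 1]. *)
Definition S_rel (F : hyperfield) (L : lieHyperalgebra F) (n : nat)
    (x y : L) : Prop :=
  exists (t : nat) (s : 'S_t) (l : 'I_t -> lie_term L)
         (w : forall i : 'I_t, lie_term_perm (l i)),
    [/\ forall (i : 'I_t) (j : 'I_(lt_arity (l i))),
          ~ @hyper_derived F L n.-1 (lt_vec j) -> lp_args (w i) j = j,
        hfold (@lh_add F L) (fun i => lt_val (l i)) x
      & hfold (@lh_add F L) (fun i => lt_val (lt_permute (w (s i)))) y].

Definition S_star (F : hyperfield) (L : lieHyperalgebra F) (n : nat) :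
    L -> L -> Prop :=
  trans_closure (@S_rel F L n).

Definition S_inter (F : hyperfield) (L : lieHyperalgebra F) (x y : L) : Prop :=
  forall n : nat, (1 <= n)%N -> S_star n x y.

Definition L_rel (F : hyperfield) (L : lieHyperalgebra F) (x y : L) : Prop :=
  exists (t : nat) (l : 'I_t -> lie_term L),
    hfold (@lh_add F L) (fun i => lt_val (l i)) x /\
    hfold (@lh_add F L) (fun i => lt_val (l i)) y.

Definition L_star (F : hyperfield) (L : lieHyperalgebra F) : L -> L -> Prop :=
  trans_closure (@L_rel F L).

HB.mixin Record Lmodule_isLieAlgebra (K : fieldType) M of GRing.Lmodule K M := {
  lie_bracket : M -> M -> M;
  lie_linearl : forall y, linear (fun x => lie_bracket x y);
  lie_linearr : forall x, linear (lie_bracket x);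
  lie_alternating : forall x, lie_bracket x x = 0;
  lie_jacobi : forall x y z,
    lie_bracket x (lie_bracket y z) + lie_bracket y (lie_bracket z x)
    + lie_bracket z (lie_bracket x y) = 0
}.

#[short(type="lieAlgType")]
HB.structure Definition LieAlgebra (K : fieldType) :=
  {M of GRing.Lmodule K M & Lmodule_isLieAlgebra K M}.

Definition linear_span (K : fieldType) (M : lmodType K) (A : set M) : set M :=
  [set v | exists (n : nat) (c : 'I_n -> K) (a : 'I_n -> M),
     (forall i, A (a i)) /\ v = \sum_(i < n) c i *: a i].

Fixpoint derived (K : fieldType) (M : lieAlgType K) (n : nat) : set M :=
  if n is n'.+1 then
    linear_span [set lie_bracket x y | x in @derived K M n' & y in @derived K M n']
  else setT.

Definition solvable_lie (K : fieldType) (M : lieAlgType K) : Prop :=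
  exists m : nat, @derived K M m = [set 0].

Definition finite_dimensional (K : fieldType) (M : lmodType K) : Prop :=
  exists (n : nat) (e : 'I_n -> M), linear_span (range e) = setT.

Record quot (T : Type) (e : T -> T -> Prop) := Quot {
  quot_set : set T;
  quot_setP : exists x, quot_set = [set y | e x y]
}.

Definition cls (T : Type) (e : T -> T -> Prop) (x : T) : quot e :=
  @Quot T e [set y | e x y] (ex_intro _ x erefl).

(* [qop] is the operation induced on classes by [op]: the class of [z] does not
   depend on the representatives [x], [y], nor on [z \in op x y]. *)
Definition induced (A B C : Type) (eA : A -> A -> Prop) (eB : B -> B -> Prop)
    (eC : C -> C -> Prop) (op : A -> B -> set C)
    (qop : quot eA -> quot eB -> quot eC) : Prop :=
  forall x y z, op x y z -> qop (cls eA x) (cls eB y) = cls eC z.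

Record quot_field (F : hyperfield) (d : F -> F -> Prop) := QuotField {
  qf_class : GRing.Field (quot d);
  qf_field : fieldType := GRing.Field.Pack qf_class;
  qf_add : induced (@hf_add F) (fun a b : qf_field => a + b);
  qf_mul : induced (@hf_mul F) (fun a b : qf_field => a * b)
}.

Record quot_lie (F : hyperfield) (L : lieHyperalgebra F) (d : F -> F -> Prop)
    (r : L -> L -> Prop) := QuotLie {
  ql_quot_field : quot_field d;
  ql_field : fieldType := qf_field ql_quot_field;
  ql_class : LieAlgebra ql_field (quot r);
  ql_lie : lieAlgType ql_field := LieAlgebra.Pack ql_class;
  ql_add : induced (@lh_add F L) (fun x y : ql_lie => x + y);
  ql_scale : induced (@lh_scale F L) (fun (a : ql_field) (x : ql_lie) => a *: x);
  ql_bracket : induced (@lh_bracket F L) (fun x y : ql_lie => lie_bracket x y)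
}.

Definition solvable_lie_quotient (F : hyperfield) (L : lieHyperalgebra F)
    (r : L -> L -> Prop) : Prop :=
  exists d : F -> F -> Prop,
    strongly_regular d /\
    exists Q : quot_lie d r, solvable_lie (ql_lie Q).

(* Main.v *)
Require Import Defs.
From HB Require Import structures.
From mathcomp Require Import all_boot all_algebra all_fingroup.
From mathcomp Require Import boolp classical_sets.
From Stdlib Require Import Relation_Operators.

Set Implicit Arguments.
Unset Strict Implicit.
Unset Printing Implicit Defensive.

Import Defs GRing.Theory.

Local Open Scope classical_set_scope.
Local Open Scope ring_scope.

(** Everything happens in the fundamental Lie algebra [M := L / L*].

Let [Q] be any Lie algebra quotient of [L].  A hyperexpression has only one
class in [Q], obtained by replacing every hyperoperation by the operation of
[Q].  Since addition in [Q] and the operations of its field are commutative, the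
permutations of the summands and of the scalars in the definition of [S_n] are
invisible there, and two [S_n]-related elements differ by a sum of differences
[f(v_1, ..., v_m) - f(v_s(1), ..., v_s(m))] of bracket monomials.  The
permutation [s] moves only arguments coming from the [(n-1)]-st hyper derived
set, hence lying in the ideal [Q^(n-1)], so these differences lie in [Q^(n-1)]
([S_star_derived]).  If [Q^(m) = 0], then [S_(m+1)*], and a fortiori the
intersection, is contained in the relation defining [Q]: this is minimality
([solvable_quotient_S_inter]).

Conversely, the ideal [M^(n)] is spanned by the brackets [a, b] of classes of
elements of the [(n-1)]-st hyper derived set.  Exchanging the arguments of
[(c/2) a, b] turns its class into the opposite one, so the class of an element
in [M] changes by [c] times that of [a, b] while its [S_n*]-class stays the same
([S_star_bracket]).  Summing up, elements of [L] whose classes in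
[M] differ by an element of [M^(n)] are [S_n*]-related ([derived_S_star]).
The division by 2 takes place in [F / gamma*], where [2 = 0] would mean that
some element of [1 + 1] is [gamma*]-related to [0]; as a [gamma*]-relation
becomes an equality in every field quotient of [F], [2 = 0] would hold in
[F / alpha*] too ([two_neq0_gamma]).

Finally [M] is finite dimensional, so its derived series is constant from some
[N] on ([decreasing_subspaces_stabilize]).  The two inclusions then say that
[S_inter] is the congruence modulo the ideal [M^(N)], and the quotient of [L] by
it is the solvable Lie algebra [M / M^(N)]. *)

(** * Subspaces and chain conditions *)

Section Subspaces.
Variables (K : fieldType) (M : lmodType K).
Implicit Types (A B : set M).

Definition subspace A : Prop :=
  [/\ A 0, forall x y, A x -> A y -> A (x + y) & forall c x, A x -> A (c *: x)].

Lemma subspaceN A x : subspace A -> A x -> A (- x).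
Proof. by case=> _ _ AZ Ax; rewrite -scaleN1r; exact: AZ. Qed.

Lemma subspaceB A x y : subspace A -> A x -> A y -> A (x - y).
Proof. by move=> sA Ax Ay; case: (sA) => _ AD _; apply: AD => //; exact: subspaceN. Qed.

Lemma subspace_sum A n (f : 'I_n -> M) :
  subspace A -> (forall i, A (f i)) -> A (\sum_i f i).
Proof. by case=> A0 AD _ Af; elim/big_rec: _ => // i x _ Ax; exact: AD. Qed.

Lemma sub_span A : A `<=` linear_span A.
Proof.
move=> x Ax; exists 1%N, (fun=> 1), (fun=> x).
by rewrite big_ord1 scale1r.
Qed.

Lemma subspace_span A : subspace (linear_span A).
Proof.
split=> [|x y [n [c [a [Aa ->]]]] [m [c' [a' [Aa' ->]]]]|k x [n [c [a [Aa ->]]]]].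
- exists 0%N, (fun=> 0), (fun=> 0); split; last by rewrite big_ord0.
  by case.
- exists (n + m)%N,
    (fun i => match split i with inl j => c j | inr j => c' j end),
    (fun i => match split i with inl j => a j | inr j => a' j end).
  split=> [i|]; first by case: (split i).
  rewrite big_split_ord /=; congr (_ + _); apply: eq_bigr => i _.
    by rewrite (unsplitK (inl i)).
  by rewrite (unsplitK (inr i)).
- exists n, (fun i => k * c i), a; split=> //.
  by rewrite scaler_sumr; apply: eq_bigr => i _; rewrite scalerA.
Qed.

Lemma span_min A B : subspace B -> A `<=` B -> linear_span A `<=` B.
Proof.
move=> sB AB x [n [c [a [Aa ->]]]]; apply: subspace_sum => // i.
by case: sB => _ _; apply; exact/AB.
Qed.

End Subspaces.

(** Among the matrices with all rows in [P], one of maximal rank works: a vector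
of [P] outside of its row space could be added to it.  The induction is on the
gap between the rank and [d]. *)
Lemma subspace_rowspace (K : fieldType) d (P : set 'rV[K]_d) :
  subspace P -> exists A : 'M[K]_d, forall r, P r <-> (r <= A)%MS.
Proof.
move=> sP.
suff main k (A : 'M[K]_d) : (d - \rank A <= k)%N -> (forall i, P (row i A)) ->
    exists A : 'M[K]_d, forall r, P r <-> (r <= A)%MS.
  apply: (main d (0 : 'M_d)) => [|i]; first by rewrite leq_subr.
  by rewrite row0; case: sP.
have Psub (B : 'M[K]_d) r : (forall i, P (row i B)) -> (r <= B)%MS -> P r.
  move=> PB /submxP[u ->]; rewrite mulmx_sum_row.
  by apply: subspace_sum => // i; case: sP => _ _; apply.
elim: k A => [|k IHk] A rkA PA.
  exists A => r; split=> [_|/Psub]; last exact.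
  apply: submx_full; rewrite /row_full eqn_leq rank_leq_col /=.
  by rewrite -subn_eq0 -leqn0.
have [PleA|/existsNP[r /not_implyP[Pr rA]]] := EM (forall r, P r -> (r <= A)%MS).
  by exists A => r; split=> [/PleA//|/Psub]; exact.
apply: (IHk (A + r)%MS).
  have : (A < A + r)%MS.
    rewrite /ltmx addsmxSl /=; apply/negP => le_A.
    by apply: rA; exact: submx_trans (addsmxSr _ _) le_A.
  move/rank_ltmx => lt_rk; rewrite leq_subLR.
  by rewrite leq_subLR in rkA; rewrite (leq_trans rkA)// addnS -addSn leq_add2r.
move=> i; have /sub_addsmxP[[u v] /= ->] := row_sub i (A + r)%MS.
case: (sP) => _ PD PZ; apply: PD; first exact: Psub (submxMl _ _).
by rewrite [v]mx11_scalar mul_scalar_mx; exact: PZ.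
Qed.

(** A spanning family of [d] vectors turns each [W k] into a subspace of ['rV_d],
hence into the row space of a matrix [A k]; the sequence is stationary from any
[N] for which the rank of [A N] is minimal. *)
Lemma decreasing_subspaces_stabilize (K : fieldType) (M : lmodType K)
    (W : nat -> set M) :
  finite_dimensional M -> (forall k, subspace (W k)) ->
  (forall k, W k.+1 `<=` W k) -> exists N, forall k, W N `<=` W k.
Proof.
move=> [d [e spane]] sW decr.
pose phi (r : 'rV[K]_d) : M := \sum_i r 0 i *: e i.
have phiD r r' : phi (r + r') = phi r + phi r'.
  by rewrite -big_split; apply: eq_bigr => i _; rewrite mxE scalerDl.
have phiZ c r : phi (c *: r) = c *: phi r.
  by rewrite scaler_sumr; apply: eq_bigr => i _; rewrite mxE scalerA.
have phi_surj w : exists r, w = phi r.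
  have : linear_span (range e) w by rewrite spane.
  apply: (@span_min _ _ _ [set w | exists r, w = phi r]) => [|x [i _ <-]].
    split=> [|x y [r ->] [r' ->]|c x [r ->]].
    - by exists 0; rewrite /phi big1 // => i _; rewrite mxE scale0r.
    - by exists (r + r').
    - by exists (c *: r).
  exists (delta_mx 0 i); rewrite /phi (bigD1 i) //= mxE !eqxx scale1r.
  by rewrite big1 ?addr0 // => j /negPf ji; rewrite mxE ji andbF scale0r.
have sP k : subspace [set r | W k (phi r)].
  case: (sW k) => W0 WD WZ; split=> /= [|x y Wx Wy|c x Wx].
  - suff -> : phi 0 = 0 by [].
    by rewrite /phi big1 // => i _; rewrite mxE scale0r.
  - by rewrite phiD; exact: WD.
  - by rewrite phiZ; exact: WZ.
have [A AP] := choice (fun k => subspace_rowspace (sP k)).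
have [m /asboolP[N <-] minN] := ex_minnP (P := fun m => `[< exists k, \rank (A k) = m >])
  (ex_intro _ (\rank (A 0%N)) (asboolT (ex_intro _ 0%N erefl))).
have antiW i j : (i <= j)%N -> W j `<=` W i.
  move/subnK <-; elim: (j - i)%N => // k IHk x.
  by rewrite addSn => /decr; exact: IHk.
exists N => k w Ww; have [/antiW|/ltnW leNk] := leqP k N; first exact.
have [r wr] := phi_surj w; rewrite wr; apply/(AP k).
have le_AkN : (A k <= A N)%MS.
  by apply/row_subP => i; apply/(AP N)/(antiW _ _ leNk)/(AP k)/row_sub.
apply: (@submx_trans _ _ _ _ _ _ (A N)); first by apply/(AP N); rewrite /= -wr.
rewrite -(geq_leqif (mxrank_leqif_sup le_AkN)); apply: minN.
by apply/asboolP; exists k.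
Qed.

(** * Derived series of a Lie algebra *)

Section LieAlgebras.
Variables (K : fieldType) (M : lieAlgType K).
Implicit Types (x y z : M) (A : set M).

Lemma lie_bracketDl x x' y :
  lie_bracket (x + x') y = lie_bracket x y + lie_bracket x' y.
Proof. by have := lie_linearl y 1 x x'; rewrite !scale1r. Qed.

Lemma lie_bracketDr x y y' :
  lie_bracket x (y + y') = lie_bracket x y + lie_bracket x y'.
Proof. by have := lie_linearr x 1 y y'; rewrite !scale1r. Qed.

Lemma lie_bracket0l y : lie_bracket 0 y = 0.
Proof. by apply: (@addrI _ (lie_bracket 0 y)); rewrite -lie_bracketDl !addr0. Qed.

Lemma lie_bracket0r x : lie_bracket x 0 = 0.
Proof. by apply: (@addrI _ (lie_bracket x 0)); rewrite -lie_bracketDr !addr0. Qed.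

Lemma lie_bracketZl c x y : lie_bracket (c *: x) y = c *: lie_bracket x y.
Proof. by have := lie_linearl y c x 0; rewrite lie_bracket0l !addr0. Qed.

Lemma lie_bracketZr c x y : lie_bracket x (c *: y) = c *: lie_bracket x y.
Proof. by have := lie_linearr x c y 0; rewrite lie_bracket0r !addr0. Qed.

Lemma lie_bracketNl x y : lie_bracket (- x) y = - lie_bracket x y.
Proof. by rewrite -scaleN1r lie_bracketZl scaleN1r. Qed.

Lemma lie_bracketNr x y : lie_bracket x (- y) = - lie_bracket x y.
Proof. by rewrite -scaleN1r lie_bracketZr scaleN1r. Qed.

Lemma lie_bracketC x y : lie_bracket x y = - lie_bracket y x.
Proof.
apply/eqP; rewrite -addr_eq0; apply/eqP.
have := lie_alternating (x + y).
by rewrite lie_bracketDl !lie_bracketDr !lie_alternating add0r addr0.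
Qed.

Definition ideal A : Prop :=
  subspace A /\ forall x a, A a -> A (lie_bracket x a).

Lemma ideal_bracketr A a x : ideal A -> A a -> A (lie_bracket a x).
Proof.
by case=> sA AB Aa; rewrite lie_bracketC; apply: subspaceN => //; exact: AB.
Qed.

Lemma ideal_derived n : ideal (@derived K M n).
Proof.
elim: n => [|n IHn] //; split; first exact: subspace_span.
move=> x a; case: (subspace_span
  [set lie_bracket x y | x in @derived K M n & y in @derived K M n]) => S0 SD SZ.
apply: (@span_min _ _ _ [set a | @derived K M n.+1 (lie_bracket x a)]).
  split=> /= [|u v Su Sv|c u Su].
  - by rewrite lie_bracket0r.
  - by rewrite lie_bracketDr; exact: SD.
  - by rewrite lie_bracketZr; exact: SZ.
case: IHn => _ Dn _ [u Du [v Dv <-]] /=.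
(* The Jacobi identity as a derivation rule:
   [x, [u, v]] = [u, [x, v]] + [[x, u], v]. *)
have -> : lie_bracket x (lie_bracket u v) =
    lie_bracket u (lie_bracket x v) + lie_bracket (lie_bracket x u) v.
  have /eqP := lie_jacobi x u v.
  rewrite -addrA addr_eq0 => /eqP ->; rewrite opprD; congr (_ + _).
    by rewrite [lie_bracket v x]lie_bracketC lie_bracketNr opprK.
  by rewrite -lie_bracketC.
apply: SD; apply: sub_span.
  by exists u => //; exists (lie_bracket x v) => //; exact: Dn.
by exists (lie_bracket x u); [exact: Dn | exists v].
Qed.

Lemma subspace_derived n : subspace (@derived K M n).
Proof. by case: (ideal_derived n). Qed.

Lemma derived_bracket n x y :
  @derived K M n x -> @derived K M n y -> @derived K M n.+1 (lie_bracket x y).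
Proof. by move=> Dx Dy; apply: sub_span; exists x => //; exists y. Qed.

Lemma derived_decr n : @derived K M n.+1 `<=` @derived K M n.
Proof.
apply: span_min; first exact: subspace_derived.
by move=> _ [x _ [y Dy <-]]; case: (ideal_derived n) => _; apply.
Qed.

Fixpoint lie_monomial m (v : 'I_m -> M) (f : monomial m) : M :=
  match f with
  | Leaf i => v i
  | Bracket f1 f2 => lie_bracket (lie_monomial v f1) (lie_monomial v f2)
  end.

Lemma lie_monomial_ideal A m (v : 'I_m -> M) (f : monomial m) j :
  ideal A -> j \in leaves f -> A (v j) -> A (lie_monomial v f).
Proof.
move=> iA + Avj; elim: f => [i|f1 IH1 f2 IH2] /=.
  by rewrite inE => /eqP <-.
rewrite mem_cat => /orP[/IH1|/IH2]; first exact: ideal_bracketr.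
by case: iA => _; apply.
Qed.

(** Unless it is trivial, a permutation that only moves arguments lying in an
ideal moves an argument [j] to another moved one, so that both monomials have an
argument from the ideal at the position [j]. *)
Lemma lie_monomial_perm A m (v : 'I_m -> M) (f : monomial m) (s : 'S_m) :
  ideal A -> (forall j, j \in leaves f) -> (forall j, ~ A (v j) -> s j = j) ->
  A (lie_monomial v f - lie_monomial (fun j => v (s j)) f).
Proof.
move=> iA fP sP; case: (iA) => sA _.
have [s1|/existsNP[j sj]] := EM (forall j, s j = j).
  have -> : (fun j => v (s j)) = v by apply/funext => j; rewrite s1.
  by rewrite subrr; case: sA.
have Av k : s k <> k -> A (v k) by move=> sk; apply: contrapT => /sP.
apply: subspaceB => //; first by apply: (lie_monomial_ideal iA (fP j)); exact: Av.
by apply: (lie_monomial_ideal iA (fP j)) => /=; apply: Av => /perm_inj.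
Qed.

End LieAlgebras.

(** * Quotients by ideals *)

(** A surjection from [M] to a bare type whose fibres are the cosets of an ideal. *)
Record ideal_quotient (K : fieldType) (M : lieAlgType K) (T : Type) := IdealQuotient {
  iq_ideal : set M;
  iq_idealP : ideal iq_ideal;
  iq_proj : M -> T;
  iq_sect : T -> M;
  iq_sectK : forall t, iq_proj (iq_sect t) = t;
  iq_projP : forall x y, iq_proj x = iq_proj y <-> iq_ideal (x - y)
}.

Section IdealQuotient.
Variables (K : fieldType) (M : lieAlgType K) (T : Type).

(** An alias of [T] that remembers [q], so that the algebraic structures can be
attached to it; it unfolds to [T], and the structures can therefore be read on
[T] itself. *)
Definition iq_carrier (q : ideal_quotient M T) : Type := T.

Variable q : ideal_quotient M T.
Local Notation QT := (iq_carrier q).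
Local Notation I := (iq_ideal q).
Local Notation sect := (@iq_sect K M T q).

Definition iq_pi (x : M) : QT := iq_proj q x.
Local Notation pi := iq_pi.

Definition iq_add (s t : QT) : QT := pi (sect s + sect t).
Definition iq_opp (s : QT) : QT := pi (- sect s).
Definition iq_scale (c : K) (s : QT) : QT := pi (c *: sect s).
Definition iq_bracket (s t : QT) : QT := pi (lie_bracket (sect s) (sect t)).

Lemma iq_piP x y : I (x - y) -> pi x = pi y.
Proof. by move/iq_projP. Qed.

Lemma iq_surj (t : QT) : exists x, t = pi x.
Proof. by exists (sect t); rewrite /iq_pi iq_sectK. Qed.

Lemma iq_sect_pi x : I (sect (pi x) - x).
Proof. by apply/iq_projP; rewrite iq_sectK. Qed.

Lemma iq_piD x y : iq_add (pi x) (pi y) = pi (x + y).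
Proof.
apply: iq_piP; rewrite opprD addrACA.
by case: (iq_idealP q) => -[_ ID _] _; apply: ID; exact: iq_sect_pi.
Qed.

Lemma iq_piN x : iq_opp (pi x) = pi (- x).
Proof.
apply: iq_piP; rewrite -opprD; apply: subspaceN; last exact: iq_sect_pi.
by case: (iq_idealP q).
Qed.

Lemma iq_piZ c x : iq_scale c (pi x) = pi (c *: x).
Proof.
apply: iq_piP; rewrite -scalerBr.
by case: (iq_idealP q) => -[_ _ IZ] _; apply: IZ; exact: iq_sect_pi.
Qed.

Lemma iq_piB x y : iq_bracket (pi x) (pi y) = pi (lie_bracket x y).
Proof.
apply: iq_piP; set x' := sect _; set y' := sect _.
have -> : lie_bracket x' y' - lie_bracket x y =
    lie_bracket (x' - x) y' + lie_bracket x (y' - y).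
  by rewrite lie_bracketDl lie_bracketDr lie_bracketNl lie_bracketNr addrA subrK.
have iI := iq_idealP q; case: (iI) => -[_ ID _] Ibr; apply: ID.
  by apply: ideal_bracketr => //; exact: iq_sect_pi.
by apply: Ibr; exact: iq_sect_pi.
Qed.

Fact iq_addA : associative iq_add.
Proof.
move=> s t u; have [[x ->] [[y ->] [z ->]]] := (iq_surj s, (iq_surj t, iq_surj u)).
by rewrite !iq_piD addrA.
Qed.

Fact iq_addC : commutative iq_add.
Proof.
move=> s t; have [[x ->] [y ->]] := (iq_surj s, iq_surj t).
by rewrite !iq_piD addrC.
Qed.

Fact iq_add0 : left_id (pi 0) iq_add.
Proof. by move=> s; have [x ->] := iq_surj s; rewrite iq_piD add0r. Qed.

Fact iq_addN : left_inverse (pi 0) iq_opp iq_add.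
Proof. by move=> s; have [x ->] := iq_surj s; rewrite iq_piN iq_piD addNr. Qed.

HB.instance Definition _ := gen_eqMixin QT.
HB.instance Definition _ := gen_choiceMixin QT.
HB.instance Definition _ :=
  GRing.isZmodule.Build QT iq_addA iq_addC iq_add0 iq_addN.

Lemma iq_addE x y : pi x + pi y = pi (x + y).
Proof. exact: iq_piD. Qed.

Fact iq_scaleA a b (s : QT) : iq_scale a (iq_scale b s) = iq_scale (a * b) s.
Proof. by have [x ->] := iq_surj s; rewrite !iq_piZ scalerA. Qed.

Fact iq_scale1 : left_id 1 iq_scale.
Proof. by move=> s; have [x ->] := iq_surj s; rewrite iq_piZ scale1r. Qed.

Fact iq_scaleDr : right_distributive iq_scale +%R.
Proof.
move=> c s t; have [[x ->] [y ->]] := (iq_surj s, iq_surj t).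
by rewrite iq_addE !iq_piZ scalerDr -iq_addE.
Qed.

Fact iq_scaleDl (s : QT) : {morph iq_scale^~ s : a b / a + b}.
Proof.
by move=> a b; have [x ->] := iq_surj s; rewrite !iq_piZ scalerDl -iq_addE.
Qed.

HB.instance Definition _ :=
  GRing.Zmodule_isLmodule.Build K QT iq_scaleA iq_scale1 iq_scaleDr iq_scaleDl.

Lemma iq_scaleE c x : c *: pi x = pi (c *: x).
Proof. exact: iq_piZ. Qed.

Fact iq_linearl (t : QT) : linear (fun s => iq_bracket s t).
Proof.
move=> c s s'; have [[x ->] [[x' ->] [y ->]]] := (iq_surj s, (iq_surj s', iq_surj t)).
rewrite iq_scaleE iq_addE !iq_piB iq_scaleE iq_addE.
by rewrite lie_bracketDl lie_bracketZl.
Qed.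

Fact iq_linearr (s : QT) : linear (iq_bracket s).
Proof.
move=> c t t'; have [[x ->] [[y ->] [y' ->]]] := (iq_surj s, (iq_surj t, iq_surj t')).
rewrite iq_scaleE iq_addE !iq_piB iq_scaleE iq_addE.
by rewrite lie_bracketDr lie_bracketZr.
Qed.

Fact iq_alternating (s : QT) : iq_bracket s s = 0.
Proof. by have [x ->] := iq_surj s; rewrite iq_piB lie_alternating. Qed.

Fact iq_jacobi (s t u : QT) :
  iq_bracket s (iq_bracket t u) + iq_bracket t (iq_bracket u s)
  + iq_bracket u (iq_bracket s t) = 0.
Proof.
have [[x ->] [[y ->] [z ->]]] := (iq_surj s, (iq_surj t, iq_surj u)).
by rewrite !iq_piB !iq_addE lie_jacobi.
Qed.

HB.instance Definition _ := Lmodule_isLieAlgebra.Build K QT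
  iq_linearl iq_linearr iq_alternating iq_jacobi.

(** Derived ideals of the quotient lift to those of [M], because representatives
can be chosen in [derived n] before taking brackets and linear combinations. *)
Lemma iq_derived n (t : QT) :
  @derived K QT n t -> exists2 x, @derived K M n x & t = pi x.
Proof.
elim: n t => [|n IHn] t; first by have [x ->] := iq_surj t; exists x.
have sD := subspace_derived M n.+1.
apply: (@span_min _ _ _ [set t : QT | exists2 x, @derived K M n.+1 x & t = pi x]).
  case: sD => D0 DD DZ; split=> [|_ _ [x Dx ->] [y Dy ->]|c _ [x Dx ->]].
  - by exists 0.
  - by exists (x + y); [exact: DD | rewrite iq_addE].
  - by exists (c *: x); [exact: DZ | rewrite iq_scaleE].
move=> _ [s /IHn[x Dx ->] [u /IHn[y Dy ->] <-]].
by exists (lie_bracket x y); [exact: derived_bracket | exact: iq_piB].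
Qed.

Lemma iq_solvable n : @derived K M n `<=` I -> solvable_lie QT.
Proof.
move=> DI; exists n; apply/seteqP; split=> [t /iq_derived[x /DI Ix ->]|_ ->] /=.
  by apply: iq_piP; rewrite subr0.
by case: (subspace_derived QT n).
Qed.

End IdealQuotient.

(** * Classes and values of hyperexpressions *)

Lemma quot_surj (T : Type) (e : T -> T -> Prop) (q : quot e) : exists x, q = cls e x.
Proof.
case: q => A qP; have [x Ax] := qP; exists x; subst A.
by congr Quot; exact: Prop_irrelevance.
Qed.

Lemma cls_eq (T : Type) (e : T -> T -> Prop) x y :
  is_equivalence e -> cls e x = cls e y <-> e x y.
Proof.
case=> refl tr sym; split=> [/(congr1 (@quot_set T e)) /= exy|exy].
  by have : [set z | e y z] y by []; rewrite -exy.
have E : [set z | e x z] = [set z | e y z].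
  apply/seteqP; split=> z /= ez; first exact: tr (sym _ _ exy) ez.
  exact: tr exy ez.
rewrite /cls; move: (ex_intro _ x _) (ex_intro _ y _); rewrite E => p p'.
by congr Quot; exact: Prop_irrelevance.
Qed.

Lemma trans_closure_equivalence (T : Type) (r : T -> T -> Prop) :
  (forall x, r x x) -> (forall x y, r x y -> r y x) ->
  is_equivalence (trans_closure r).
Proof.
move=> refl sym; split=> [x|x y z|x y].
- exact: t_step.
- exact: t_trans.
- elim=> [u v /sym|u v w _ IH1 _ IH2]; first exact: t_step.
  exact: t_trans IH2 IH1.
Qed.

Lemma lift_set1 (A B C : Type) (op : A -> B -> set C) a b :
  lift op [set a] [set b] = op a b.
Proof. by rewrite /lift !bigcup_set1. Qed.

Lemma lift_neq0 (A B C : Type) (op : A -> B -> set C) X Y :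
  nonempty_valued op -> X !=set0 -> Y !=set0 -> lift op X Y !=set0.
Proof.
by move=> op0 [x Xx] [y Yy]; have [z] := op0 x y; exists z, x => //; exists y.
Qed.

Lemma enum_ord1 : enum 'I_1 = [:: ord0].
Proof. by apply: (inj_map val_inj); rewrite val_enum_ord. Qed.

Lemma enum_ord2 : enum 'I_2 = [:: ord0; ord_max].
Proof. by apply: (inj_map val_inj); rewrite val_enum_ord. Qed.

Lemma hfold1 (T : Type) (op : T -> T -> set T) (X : 'I_1 -> set T) :
  hfold op X = X ord0.
Proof. by rewrite /hfold enum_ord1. Qed.

Lemma hfold2 (T : Type) (op : T -> T -> set T) (X : 'I_2 -> set T) :
  hfold op X = lift op (X ord0) (X ord_max).
Proof. by rewrite /hfold enum_ord2. Qed.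

(** If [h] maps a hyperoperation to an ordinary operation and is constant on each
operand, it is constant on the iterated hyperoperation. *)
Lemma hfold_morph (T R : Type) (idx : R) (opR : Monoid.com_law idx)
    (op : T -> T -> set T) (h : T -> R) n (X : 'I_n -> set T) (v : 'I_n -> R) :
  (forall x y z, op x y z -> h z = opR (h x) (h y)) ->
  (forall i u, X i u -> h u = v i) ->
  forall x, hfold op X x -> h x = \big[opR/idx]_i v i.
Proof.
move=> hop hX x; rewrite -big_enum /= /hfold; move: x.
have foldP s Y a : (forall u, Y u -> h u = a) ->
    forall x, foldl (lift op) Y [seq X i | i <- s] x ->
    h x = opR a (\big[opR/idx]_(i <- s) v i).
  elim: s Y a => [|i s IHs] Y a hY x /=.
    by rewrite big_nil Monoid.mulm1; exact: hY.
  rewrite big_cons Monoid.mulmA; apply: IHs => u [y Yy [z Xz]].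
  by move=> /hop ->; rewrite (hY _ Yy) (hX i).
by case: (enum _) => [|i s] x //=; rewrite big_cons; apply: foldP => u; exact: hX.
Qed.

Section ScalarClasses.
Variables (F : hyperfield) (d : F -> F -> Prop) (Q : quot_field d).

Definition fcls (a : F) : qf_field Q := cls d a.

Lemma fcls_add a b c : hf_add a b c -> fcls c = fcls a + fcls b.
Proof. by move=> abc; exact: esym (qf_add Q abc). Qed.

Lemma fcls_mul a b c : hf_mul a b c -> fcls c = fcls a * fcls b.
Proof. by move=> abc; exact: esym (qf_mul Q abc). Qed.

Lemma fcls_surj (c : qf_field Q) : exists a, c = fcls a.
Proof. exact: quot_surj. Qed.

Lemma fcls0 : fcls (hf_zero F) = 0.
Proof.
apply: (@addrI _ (fcls (hf_zero F))); rewrite addr0 -(fcls_add (c := hf_zero F)) //.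
by have [-> _] := hf_add0 (hf_zero F).
Qed.

(** The unit [1] of [F] only satisfies [b \in 1 b]; taking for [b] a
representative of the unit of the quotient gives the result. *)
Lemma fcls1 : fcls (hf_one F) = 1.
Proof.
have [b b1] := fcls_surj 1.
have [/fcls_mul + _] := hf_mul1 b.
by rewrite -b1 mulr1.
Qed.

Definition sp_cls (E : sum_prod F) : qf_field Q :=
  \sum_(i < sp_len E) \prod_(j < sp_deg i) fcls (sp_arg j).

(** All values of a sum of products have the same class: this is what makes
permuted expressions comparable in the quotient. *)
Lemma sp_val_cls E a : sp_val E a -> fcls a = sp_cls E.
Proof.
apply: hfold_morph; first exact: fcls_add.
move=> i; apply: hfold_morph; first exact: fcls_mul.
by move=> j u ->.
Qed.

Lemma sp_cls_permute E (s : 'S_(sp_len E)) u : sp_cls (sp_permute s u) = sp_cls E.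
Proof.
rewrite /sp_cls [RHS](reindex_inj (@perm_inj _ s)) /=; apply: eq_bigr => i _.
by symmetry; exact: (reindex_inj (F := fun j => fcls (sp_arg j)) (@perm_inj _ (u (s i)))).
Qed.

Lemma strongly_regular_quot_field : is_equivalence d -> strongly_regular d.
Proof.
move=> ed; split=> // x y /(cls_eq _ _ ed) dxy a.
have {}dxy : fcls x = fcls y := dxy.
by split=> u v uP vP; apply/(cls_eq _ _ ed); change (fcls u = fcls v);
  rewrite ?(fcls_add uP) ?(fcls_add vP) ?(fcls_mul uP) ?(fcls_mul vP) dxy.
Qed.

End ScalarClasses.

Lemma sp_val_permute1 (F : hyperfield) (E : sum_prod F) :
  sp_val (sp_permute 1%g (fun i : 'I_(sp_len E) => 1%g : 'S_(sp_deg i))) = sp_val E.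
Proof.
pose X (i : 'I_(sp_len E)) :=
  hfold (@hf_mul F) (fun j : 'I_(sp_deg i) => [set sp_arg ((1%g : 'S__) j)]).
rewrite /sp_val /=; congr hfold; transitivity (fun i => X ((1%g : 'S__) i)) => //.
by apply/funext => i; rewrite perm1 /X; congr hfold; apply/funext => j; rewrite perm1.
Qed.

(** The scalar [a] as a one-term sum of one-factor products.  It is its own image
under [sp_permute] by computation, which keeps the terms built from it simple. *)
Definition sp_const (R : Type) (a : R) : sum_prod R :=
  @SumProd R 1 (fun=> 1%N) (fun _ _ => a).

Lemma sp_val_const (F : hyperfield) (a : F) : sp_val (sp_const a) = [set a].
Proof. by rewrite /sp_val !hfold1. Qed.

Lemma gamma_equivalence (F : hyperfield) : is_equivalence (@gamma_star F).
Proof.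
apply: trans_closure_equivalence => [a|a b [E [Ea Eb]]]; last by exists E.
by exists (sp_const a); rewrite sp_val_const.
Qed.

(** Any field quotient of [F] factors through [gamma_star], whatever the relation
that defines it. *)
Lemma gamma_star_fcls (F : hyperfield) (d : F -> F -> Prop) (K : quot_field d) a b :
  gamma_star a b -> fcls K a = fcls K b.
Proof.
elim=> [x y [E [/(sp_val_cls K) -> /(sp_val_cls K) ->]] //|].
by move=> x y z _ -> _ ->.
Qed.

Lemma two_neq0_gamma (F : hyperfield) (d : F -> F -> Prop) (K : quot_field d)
    (Q : quot_field (@gamma_star F)) :
  2%N \notin [pchar (qf_field K)] -> 2%:R != 0 :> qf_field Q.
Proof.
apply: contraNneq => Q2; rewrite inE /=; apply/eqP.
have [z z11] := hf_add_nonempty (hf_one F) (hf_one F).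
have : gamma_star z (hf_zero F).
  apply/(cls_eq _ _ (gamma_equivalence F)); change (fcls Q z = fcls Q (hf_zero F)).
  by rewrite (fcls_add Q z11) fcls1 fcls0.
by move/(gamma_star_fcls K); rewrite (fcls_add K z11) fcls1 fcls0.
Qed.

(** * Values of Lie terms in a quotient Lie algebra *)

Section LieClasses.
Variables (F : hyperfield) (L : lieHyperalgebra F).
Variables (d : F -> F -> Prop) (r : L -> L -> Prop) (Q : quot_lie d r).

Definition lcls (x : L) : ql_lie Q := cls r x.
Local Notation scls := (@fcls F d (ql_quot_field Q)).

Lemma lcls_add x y z : lh_add x y z -> lcls z = lcls x + lcls y.
Proof. by move=> abc; exact: esym (ql_add Q abc). Qed.

Lemma lcls_scale a x z : lh_scale a x z -> lcls z = (scls a : ql_field Q) *: lcls x.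
Proof. by move=> abc; exact: esym (ql_scale Q abc). Qed.

Lemma lcls_bracket x y z : lh_bracket x y z -> lcls z = lie_bracket (lcls x) (lcls y).
Proof. by move=> abc; exact: esym (ql_bracket Q abc). Qed.

Lemma lcls_surj (q : ql_lie Q) : exists x, q = lcls x.
Proof. exact: quot_surj. Qed.

Definition lt_arg_cls (l : lie_term L) (j : 'I_(lt_arity l)) : ql_lie Q :=
  (sp_cls (ql_quot_field Q) (lt_coef j) : ql_field Q) *: lcls (lt_vec j).

Definition lt_cls (l : lie_term L) : ql_lie Q :=
  lie_monomial (@lt_arg_cls l) (lt_fun l).

Lemma lt_val_cls l x : lt_val l x -> lcls x = lt_cls l.
Proof.
rewrite /lt_val /lt_cls.
elim: (lt_fun l) x => [j|f1 IH1 f2 IH2] x /=.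
  rewrite /lt_arg_cls => -[a /(sp_val_cls (ql_quot_field Q)) <- [_ ->]].
  exact: lcls_scale.
by move=> [y /IH1 <- [z /IH2 <-]]; exact: lcls_bracket.
Qed.

Lemma hfold_lt_cls t (l : 'I_t -> lie_term L) x :
  hfold (@lh_add F L) (fun i => lt_val (l i)) x -> lcls x = \sum_i lt_cls (l i).
Proof. by apply: hfold_morph => [|i u]; [exact: lcls_add | exact: lt_val_cls]. Qed.

Lemma lt_cls_permute l (w : lie_term_perm l) :
  lt_cls (lt_permute w) = lie_monomial (fun j => lt_arg_cls (lp_args w j)) (lt_fun l).
Proof.
rewrite /lt_cls; congr (lie_monomial _ _); apply/funext => j.
by rewrite /lt_arg_cls /= sp_cls_permute.
Qed.

Lemma mem_lt_leaves (l : lie_term L) j : j \in leaves (lt_fun l).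
Proof. by rewrite (perm_mem (lt_funP l)) mem_enum. Qed.

Lemma hyper_derived_cls n x : @hyper_derived F L n x -> @derived _ (ql_lie Q) n (lcls x).
Proof.
elim: n x => [|n IHn] x //= [y /IHn Dy [z /IHn Dz /lcls_bracket ->]].
exact: derived_bracket.
Qed.

(** The permutations of summands and of scalars disappear by commutativity; what
remains of each term is a bracket monomial with arguments permuted inside the
ideal [derived n.-1]. *)
Lemma S_rel_derived n x y : S_rel n x y -> @derived _ (ql_lie Q) n.-1 (lcls x - lcls y).
Proof.
move=> [t [s [l [w [wP /hfold_lt_cls -> /hfold_lt_cls ->]]]]].
have -> : \sum_i lt_cls (lt_permute (w (s i))) = \sum_i lt_cls (lt_permute (w i)).
  symmetry.
  exact: (reindex_inj (F := fun i => lt_cls (lt_permute (w i))) (@perm_inj _ s)).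
rewrite -sumrB; apply: subspace_sum => [|i]; first exact: subspace_derived.
rewrite lt_cls_permute; apply: lie_monomial_perm => [||j Dj].
- exact: ideal_derived.
- exact: mem_lt_leaves.
- apply: wP => /hyper_derived_cls Dv; apply: Dj.
  by case: (subspace_derived (ql_lie Q) n.-1) => _ _; apply.
Qed.

Lemma S_star_derived n x y : S_star n x y -> @derived _ (ql_lie Q) n.-1 (lcls x - lcls y).
Proof.
elim=> [u v /S_rel_derived //|u v z _ Duv _ Dvz].
by rewrite -(subrK (lcls v) (lcls u)) -addrA;
  case: (subspace_derived (ql_lie Q) n.-1) => _ DD _; apply: DD.
Qed.

End LieClasses.

(** * Realising derived elements by permutations *)

Section Terms.
Variables (F : hyperfield) (L : lieHyperalgebra F).

Fact leaf_termP : perm_eq (leaves (@Leaf 1 ord0)) (enum 'I_1).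
Proof. by rewrite enum_ord1. Qed.

Definition leaf_term (z : L) : lie_term L :=
  LieTerm leaf_termP (fun=> sp_const (hf_one F)) (fun=> z).

Lemma lt_val_leaf z : lt_val (leaf_term z) = [set z].
Proof. by rewrite /lt_val /= sp_val_const lift_set1 lh_scale1. Qed.

Fact bracket_termP :
  perm_eq (leaves (Bracket (@Leaf 2 ord0) (Leaf ord_max))) (enum 'I_2).
Proof. by rewrite enum_ord2. Qed.

Definition bracket_term (c : 'I_2 -> F) (v : 'I_2 -> L) : lie_term L :=
  LieTerm bracket_termP (fun j => sp_const (c j)) v.

Lemma lt_val_bracket_neq0 c v : lt_val (bracket_term c v) !=set0.
Proof.
apply: lift_neq0; first exact: lh_bracket_nonempty;
  by rewrite /= sp_val_const lift_set1; exact: lh_scale_nonempty.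
Qed.

Definition lt_perm_id (l : lie_term L) : lie_term_perm l :=
  @LieTermPerm F L l 1%g (fun=> 1%g) (fun _ _ => 1%g).

(** The index [j] occurs in the types of the permutations of the summands and
factors, so [perm1] can only be used once the composite with the identity has
been exhibited as such. *)
Lemma lt_val_permute_id l : lt_val (lt_permute (lt_perm_id l)) = lt_val l.
Proof.
pose G (j : 'I_(lt_arity l)) := Defs.lift (@lh_scale F L)
  (sp_val (sp_permute 1%g (fun i : 'I_(sp_len (lt_coef j)) => 1%g : 'S_(sp_deg i))))
  [set lt_vec j].
rewrite /lt_val; congr monomial_val.
transitivity (fun j => G ((1%g : 'S__) j)) => //.
by apply/funext => j; rewrite perm1 /G sp_val_permute1.
Qed.

Definition bracket_swap c v : lie_term_perm (bracket_term c v) :=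
  @LieTermPerm F L (bracket_term c v) (tperm ord0 ord_max : 'S_2)
    (fun=> 1%g) (fun _ _ => 1%g).

Lemma L_star_equivalence : is_equivalence (@L_star F L).
Proof.
apply: trans_closure_equivalence => [x|x y [t [l [lx ly]]]]; last by exists t, l.
by exists 1%N, (fun=> leaf_term x); rewrite hfold1 lt_val_leaf.
Qed.

Lemma L_star_S_star n (x y : L) : L_star x y -> S_star n x y.
Proof.
elim=> [u v [t [l [lu lv]]]|u v w _ Suv _ Svw]; last exact: t_trans Suv Svw.
apply: t_step; exists t, 1%g, l, (fun i => lt_perm_id (l i)); split=> //.
  by move=> i j _; rewrite perm1.
suff -> : (fun i => lt_val (lt_permute (lt_perm_id (l ((1%g : 'S_t) i))))) =
    (fun i => lt_val (l i)) by [].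
by apply/funext => i; rewrite lt_val_permute_id perm1.
Qed.

(** The relation [S_n] applied to the sum of [z] and one bracket term, whose two
arguments are exchanged together with their scalars. *)
Lemma S_rel_swap n (c : 'I_2 -> F) (v : 'I_2 -> L) z p q x y :
  (forall j, hyper_derived n.-1 (v j)) ->
  lt_val (bracket_term c v) p ->
  lt_val (bracket_term (fun j => c (tperm ord0 ord_max j))
                       (fun j => v (tperm ord0 ord_max j))) q ->
  lh_add z p x -> lh_add z q y -> S_rel n x y.
Proof.
move=> Dv vp vq zpx zqy.
pose l (i : 'I_2) := if i == ord0 then leaf_term z else bracket_term c v.
pose w (i : 'I_2) : lie_term_perm (l i) :=
  if i == ord0 as b return
    lie_term_perm (if b then leaf_term z else bracket_term c v)
  then lt_perm_id (leaf_term z) else bracket_swap c v.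
exists 2%N, 1%g, l, w; split.
- move=> i; rewrite /w /l; case: (i == ord0) => j /=; first by rewrite perm1.
  by move=> []; exact: Dv.
- rewrite hfold2 /= lt_val_leaf; exists z => //; exists p => //.
- have -> : (fun i => lt_val (lt_permute (w ((1%g : 'S_2) i)))) =
      (fun i => lt_val (lt_permute (w i))) by apply/funext => i; rewrite perm1.
  rewrite hfold2 /= lt_val_permute_id lt_val_leaf; exists z => //; exists q => //.
Qed.

Lemma lt_cls_bracket (d : F -> F -> Prop) (r : L -> L -> Prop) (Q : quot_lie d r) c v :
  lt_cls Q (bracket_term c v) =
  lie_bracket ((fcls (ql_quot_field Q) (c ord0) : ql_field Q) *: lcls Q (v ord0))
              ((fcls (ql_quot_field Q) (c ord_max) : ql_field Q) *: lcls Q (v ord_max)).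
Proof. by rewrite /lt_cls /= /lt_arg_cls /= /sp_cls !big_ord1. Qed.

End Terms.

Lemma span_bracket (K : fieldType) (M : lieAlgType K) (A B C : set M) u v :
  subspace C -> (forall a b, A a -> B b -> C (lie_bracket a b)) ->
  linear_span A u -> linear_span B v -> C (lie_bracket u v).
Proof.
move=> [C0 CD CZ] ABC Au Bv.
apply: (@span_min _ _ _ [set u | C (lie_bracket u v)] _ _ _ Au) => [|a Aa /=].
  split=> /= [|s t Cs Ct|k s Cs]; first by rewrite lie_bracket0l.
    by rewrite lie_bracketDl; exact: CD.
  by rewrite lie_bracketZl; exact: CZ.
apply: (@span_min _ _ _ [set v | C (lie_bracket a v)] _ _ _ Bv) => [|b Bb /=].
  split=> /= [|s t Cs Ct|k s Cs]; first by rewrite lie_bracket0r.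
    by rewrite lie_bracketDr; exact: CD.
  by rewrite lie_bracketZr; exact: CZ.
exact: ABC.
Qed.

Section Fundamental.
Variables (F : hyperfield) (L : lieHyperalgebra F).
Variable Q : quot_lie (@gamma_star F) (@L_star F L).
Hypothesis two_neq0 : 2%:R != 0 :> ql_field Q.

(** Write [x] and [y] as [z + p] and [z + q], up to [L*], with [p] in the bracket
[(k/2) a, b] and [q] in the exchanged bracket [b, (k/2) a].  The classes of
[p] and [q] are opposite, so those of [x] and [y] differ by twice that of [p]. *)
Lemma S_star_bracket n (k : ql_field Q) a b x y :
  hyper_derived n.-1 a -> hyper_derived n.-1 b ->
  lcls Q x = lcls Q y + k *: lie_bracket (lcls Q a) (lcls Q b) -> S_star n x y.
Proof.
move=> Da Db xy.
have [c kc] := fcls_surj (k / 2%:R).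
pose c2 (j : 'I_2) := if j == ord0 then c else hf_one F.
pose v2 (j : 'I_2) := if j == ord0 then a else b.
set t : 'S_2 := tperm ord0 ord_max.
have [p vp] := lt_val_bracket_neq0 c2 v2.
have [q vq] := lt_val_bracket_neq0 (fun j => c2 (t j)) (fun j => v2 (t j)).
have [z pz] := lcls_surj (lcls Q x - lcls Q p).
have [x' zpx'] := lh_add_nonempty z p; have [y' zqy'] := lh_add_nonempty z q.
have S_cls u w : lcls Q u = lcls Q w -> S_star n u w.
  by move=> uw; apply/L_star_S_star/(cls_eq _ _ (L_star_equivalence L)).
have hp : lcls Q p = (k / 2%:R) *: lie_bracket (lcls Q a) (lcls Q b).
  by rewrite (lt_val_cls Q vp) lt_cls_bracket fcls1 scale1r lie_bracketZl kc.
have hq : lcls Q q = - lcls Q p.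
  rewrite hp (lt_val_cls Q vq) lt_cls_bracket /t tpermL tpermR /= fcls1 scale1r.
  by rewrite lie_bracketZr lie_bracketC scalerN kc.
apply: (t_trans _ _ _ x'); first by apply: S_cls; rewrite (lcls_add Q zpx') -pz subrK.
apply: (t_trans _ _ _ y').
  apply: t_step; apply: (S_rel_swap _ vp vq zpx' zqy').
  by move=> j; rewrite /v2; case: ifP.
apply: S_cls; rewrite (lcls_add Q zqy') -pz hq -addrA -opprD hp -scalerDl.
by rewrite -mulr2n -[_ *+ 2]mulr_natr divfK // xy addrK.
Qed.

(** The hyper derived sets involve no linear spans, but by bilinearity spans may be
taken once, at the end. *)
Lemma derived_sub_span_hyper n :
  @derived _ (ql_lie Q) n `<=` linear_span (lcls Q @` @hyper_derived F L n).
Proof.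
elim: n => [|n IHn] q.
  by have [x ->] := lcls_surj q => _; apply: sub_span; exists x.
move=> Dq; apply: (span_min _ _ Dq); first exact: subspace_span.
move=> _ [u /IHn Du [v /IHn Dv <-]]; apply: (span_bracket _ _ Du Dv).
  exact: subspace_span.
move=> _ _ [a Da <-] [b Db <-]; apply: sub_span.
have [x abx] := lh_bracket_nonempty a b; exists x; last exact: lcls_bracket.
by exists a => //; exists b.
Qed.

(** The bracket exchange is applied to the summands of a linear combination one
after the other. *)
Lemma derived_S_star n x y :
  @derived _ (ql_lie Q) n.+1 (lcls Q x - lcls Q y) -> S_star n.+1 x y.
Proof.
move=> Dxy.
pose A : set (ql_lie Q) := [set lie_bracket (lcls Q a) (lcls Q b)
  | a in @hyper_derived F L n & b in @hyper_derived F L n].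
have : linear_span A (lcls Q x - lcls Q y).
  apply: (span_min _ _ Dxy); first exact: subspace_span.
  move=> _ [u /derived_sub_span_hyper Du [v /derived_sub_span_hyper Dv <-]].
  apply: (span_bracket _ _ Du Dv); first exact: subspace_span.
  by move=> _ _ [a Da <-] [b Db <-]; apply: sub_span; exists a => //; exists b.
move=> [m [c [e [Ae xy]]]].
(* Quantifying over all pairs of a given difference makes [P] stable under sums. *)
pose P w := forall x y, lcls Q x = lcls Q y + w -> S_star n.+1 x y.
suff : P (\sum_i c i *: e i) by apply; rewrite -xy addrC subrK.
apply: big_ind => [u v|s t Ps Pt u v uv|i _ u v].
- by rewrite addr0 => uv; apply/L_star_S_star/(cls_eq _ _ (L_star_equivalence L)).
- have [z vz] := lcls_surj (lcls Q v + t).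
  apply: (t_trans _ _ _ z); first by apply: Ps; rewrite -vz uv addrAC addrA.
  exact: Pt.
- by have [a Da [b Db <-]] := Ae i; exact: S_star_bracket.
Qed.

End Fundamental.

(** * The smallest relation with solvable quotient *)

Lemma solvable_quotient_S_inter (F : hyperfield) (L : lieHyperalgebra F)
    (xi : L -> L -> Prop) x y :
  is_equivalence xi -> solvable_lie_quotient xi -> S_inter x y -> xi x y.
Proof.
move=> exi [d [_ [Q [m Qm]]]] /(_ m.+1 isT) /(S_star_derived Q) /=.
rewrite Qm => /eqP; rewrite subr_eq0 => /eqP.
by move/(cls_eq _ _ exi).
Qed.

Theorem theorem3p5 (F : hyperfield) (L : lieHyperalgebra F)
    (charF : exists K : quot_field (@alpha_star F),
               2%N \notin [pchar (qf_field K)]%R)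
    (findim : exists Q : quot_lie (@gamma_star F) (@L_star F L),
                finite_dimensional (ql_lie Q)) :
  [/\ is_equivalence (@S_inter F L),
      solvable_lie_quotient (@S_inter F L)
    & forall xi : L -> L -> Prop,
        is_equivalence xi -> solvable_lie_quotient xi ->
        forall x y : L, S_inter x y -> xi x y].
Proof.
have [K K2] := charF; have [Q Qfin] := findim.
have Q2 : 2%:R != 0 :> ql_field Q := two_neq0_gamma (ql_quot_field Q) K2.
have [N stabN] := decreasing_subspaces_stabilize Qfin
  (subspace_derived (ql_lie Q)) (@derived_decr _ (ql_lie Q)).
pose J := @derived _ (ql_lie Q) N.
have SJ x y : S_inter x y <-> J (lcls Q x - lcls Q y).
  split=> [/(_ N.+1 isT) /(S_star_derived Q)//|Jxy [|n] // _].
  by apply: (derived_S_star Q2); exact: stabN.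
have sJ : subspace J := subspace_derived _ _.
have eS : is_equivalence (@S_inter F L).
  split=> [x|x y z|x y]; rewrite !SJ.
  - by rewrite subrr; case: sJ.
  - move=> Jxy Jyz; rewrite -(subrK (lcls Q y) (lcls Q x)) -addrA.
    by case: sJ => _ JD _; exact: JD.
  - by move=> Jxy; rewrite -opprB; exact: subspaceN.
split=> //; last by move=> xi exi solxi x y; exact: solvable_quotient_S_inter.
(* The projection from [L / L*] onto [L / S], whose fibres are the cosets of [J]. *)
have [rep repK] := choice (@lcls_surj _ _ _ _ Q).
have [srep srepK] := choice (@quot_surj _ (@S_inter F L)).
pose proj (q : ql_lie Q) : quot (@S_inter F L) := cls (@S_inter F L) (rep q).
have proj_cls x : proj (lcls Q x) = cls (@S_inter F L) x.
  by apply/(cls_eq _ _ eS)/SJ; rewrite -repK subrr; case: sJ.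
have sectK s : proj (lcls Q (srep s)) = s by rewrite proj_cls.
have projP p q : proj p = proj q <-> J (p - q).
  by rewrite (cls_eq _ _ eS) SJ -!repK.
pose IQ := IdealQuotient (ideal_derived (ql_lie Q) N) sectK projP.
pose QT : lieAlgType (ql_field Q) := iq_carrier IQ.
have addS : induced (@lh_add F L) (fun x y : QT => x + y).
  move=> x y z xyz; rewrite -!proj_cls (lcls_add Q xyz); exact: iq_addE.
have scaleS : induced (@lh_scale F L) (fun (a : ql_field Q) (x : QT) => a *: x).
  move=> a x z axz; rewrite -!proj_cls (lcls_scale Q axz); exact: iq_scaleE.
have bracketS : induced (@lh_bracket F L) (fun x y : QT => lie_bracket x y).
  move=> x y z xyz; rewrite -!proj_cls (lcls_bracket Q xyz); exact: iq_piB.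
exists (@gamma_star F); split.
  exact: strongly_regular_quot_field (ql_quot_field Q) (gamma_equivalence F).
by exists (QuotLie addS scaleS bracketS); exact: (@iq_solvable _ _ _ IQ N).
Qed.
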